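(* Let $0<\mu<\beta$ and $0<\bar\sigma\le\sqrt{\mu(\beta-\mu)}$. For $p\in(0,\beta]$ let $\bar R(p)=\inf_{\mathbb{P}\in\mathcal{P}}p\,\mathbb{P}(X\ge p)$, where $\mathcal{P}$ is the set of all distributions on $[0,\beta]$ with mean $\mu$ and standard deviation at most $\bar\sigma$. Put $$\bar\sigma^*=\left(\tfrac{32}{27}(\beta-\mu)\left(\sqrt{\beta(\beta-\mu)}-(\beta-\mu)\right)\right)^{1/2}.$$ Then the optimal robust price $\bar p^*=\arg\sup_p\bar R(p)$ is $$\bar p^*=\begin{cases}p^*_l(\bar\sigma)&\text{if }\bar\sigma\le\bar\sigma^*,\\ p^*_m(\beta)&\text{if }\bar\sigma\ge\bar\sigma^*,\end{cases}$$ i.e. the supremum of $\bar R$ over $(0,\beta]$ is attained at the indicated price (at both prices if $\bar\sigma=\bar\sigma^*$).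
   Context: $p^*_m(\beta)=\beta-\sqrt{\beta(\beta-\mu)}$ and $p^*_l(\bar\sigma)=\mu-\bar\sigma\,\kappa(\mu,\bar\sigma)$, where (with real cube roots) $$\kappa(\mu,\bar\sigma)=\left(\tfrac{\mu}{\bar\sigma}+\sqrt{1+(\tfrac{\mu}{\bar\sigma})^2}\right)^{1/3}+\left(\tfrac{\mu}{\bar\sigma}-\sqrt{1+(\tfrac{\mu}{\bar\sigma})^2}\right)^{1/3}.$$ Distributions are Borel probability measures of a random variable $X$. *)

(* Defs.v *)
From HB Require Import structures.
From mathcomp Require Import all_boot all_order all_algebra.
From mathcomp Require Import all_classical all_reals all_analysis.

Set Implicit Arguments.
Unset Strict Implicit.
Unset Printing Implicit Defensive.

Import Order.TTheory GRing.Theory Num.Theory.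
Import numFieldNormedType.Exports.

Local Open Scope classical_set_scope.
Local Open Scope ring_scope.

(* Real cube root, also for negative arguments (where powR is of no use). *)
Definition cbrt (R : realType) (x : R) : R := Num.sg x * (`|x| `^ 3^-1).

Lemma cbrtK (R : realType) (x : R) : cbrt x ^+ 3 = x.
Proof.
have h : (`|x| `^ 3^-1) ^+ 3 = `|x|.
  by rewrite -powR_mulrn ?powR_ge0// -powRrM mulVf ?pnatr_eq0// powRr1.
rewrite /cbrt exprMn h [RHS]numEsg; congr (_ * _).
by case: sgrP => _; rewrite ?expr0n ?expr1n// -signr_odd expr1.
Qed.

Definition kappa (R : realType) (mu sigma : R) : R :=
  cbrt (mu / sigma + Num.sqrt (1 + (mu / sigma) ^+ 2)) +
  cbrt (mu / sigma - Num.sqrt (1 + (mu / sigma) ^+ 2)).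

Definition price_l (R : realType) (mu sigma : R) : R :=
  mu - sigma * kappa mu sigma.

Definition price_m (R : realType) (mu beta : R) : R :=
  beta - Num.sqrt (beta * (beta - mu)).

Definition sigma_star (R : realType) (mu beta : R) : R :=
  Num.sqrt (32 / 27 * (beta - mu) *
            (Num.sqrt (beta * (beta - mu)) - (beta - mu))).

(* A distribution is the law of X, so X is the identity on the real line. *)
Definition ambiguity_set (R : realType) (mu beta sigma : R) :
    set (probability (measurableTypeR R) R) :=
  [set P : probability (measurableTypeR R) R |
    [/\ P `[0, beta]%classic = 1%E,
        ('E_P[(fun x : R => x)] = mu%:E)%E &
        (sqrte 'V_P[(fun x : R => x)] <= sigma%:E)%E]].

Definition robust_revenue (R : realType) (mu beta sigma p : R) : \bar R :=
  ereal_inf [set (p%:E * P [set x : R | (p <= x)%R])%E |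
             P in ambiguity_set mu beta sigma].

(* The points of D at which the supremum of f over D is attained. *)
Definition argsup (T : Type) (R : realType) (D : set T) (f : T -> \bar R) :
    set T :=
  [set p | D p /\ f p = ereal_sup [set f q | q in D]].

(* Main.v *)
(** For [p < mu] the worst-case tail [P (X >= p)] is the larger of two lower bounds:
    Cantelli's [t^2 / (t^2 + sigma^2)] and Markov's (applied to [beta - X])
    [t / (t + beta - mu)], where [t = mu - p].  They are approached by two-point
    laws with atoms at [a < p], [a -> p], and at
    [mu + min (beta - mu) (sigma^2 / (mu - a))].  So the robust revenue is the
    maximum of two explicit curves.  The Cantelli curve peaks where
    [t^3 + 3 sigma^2 t = 2 mu sigma^2], which Cardano's formula solves by
    [t = sigma * kappa], with value [mu - 3 t / 2]; the Markov curve peaks at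
    [price_m], with value [2 beta - mu - 2 sqrt (beta (beta - mu))].
    The first value is the larger one exactly when [sigma <= sigma_star]. *)

Require Import Defs.
From HB Require Import structures.
From mathcomp Require Import all_boot all_order all_algebra.
From mathcomp Require Import all_classical all_reals all_analysis.
From mathcomp Require Import measurable_realfun ess_sup_inf.
From mathcomp Require Import ring lra.

Import Order.TTheory GRing.Theory Num.Theory.
Import numFieldNormedType.Exports.

Local Open Scope classical_set_scope.
Local Open Scope ring_scope.

(** * Integrability and variance preliminaries *)

Lemma ae_bounded_Lfun d (T : measurableType d) (R : realType)
    (P : probability T R) (X : {mfun T >-> R}) (M : R) (p : \bar R) :
  (1 <= p)%E -> (\forall x \ae P, `|X x| <= M) -> (X : T -> R) \in Lfun P p.
Proof.
move=> p1 XM; apply: (@Lfun_subset _ _ _ P p +oo%E p1 (leey _)).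
- exact: fin_num_measure.
- exact: leey.
- rewrite inE; apply/andP; split; rewrite inE//=.
  rewrite /finite_norm unlock /Lnorm; case: ifP => _; last exact: lt0y.
  apply: (@le_lt_trans _ _ M%:E); last exact: ltry.
  by apply/ess_supP; apply: filterS XM => x; rewrite /= lee_fin.
Qed.

Lemma variance_le_sqr d (T : measurableType d) (R : realType)
    (P : probability T R) (X : T -> R) (s : R) : 0 <= s ->
  (sqrte 'V_P[X] <= s%:E)%E = ('V_P[X] <= (s ^+ 2)%:E)%E.
Proof.
move=> s0; rewrite -[in RHS]lee_sqrt ?lee_fin ?sqr_ge0//=.
by rewrite sqrtr_sqr ger0_norm.
Qed.

Lemma probability1_ae d (T : measurableType d) (R : realType)
    (P : probability T R) (A : set T) (Q : T -> Prop) :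
  measurable A -> P A = 1%E -> A `<=` Q -> \forall x \ae P, Q x.
Proof.
move=> mA PA1 AQ; exists (~` A); split; first exact: measurableC.
  by rewrite probability_setC// PA1 subee.
exact: subsetC.
Qed.

(** The random variable [X] under a name, so that the measurable-function structure can be attached
    to it. *)
Definition idR (R : realType) : measurableTypeR R -> R := fun x => x.

HB.instance Definition _ (R : realType) :=
  @isMeasurableFun.Build _ _ _ _ (@idR R) (@measurable_id _ _ setT).

(** * Lower bounds on the tail, valid for every law in the ambiguity set *)

Section tail_bounds.
Context (R : realType) (mu beta sigma : R).
Variable P : probability (measurableTypeR R) R.
Hypotheses (sigma_gt0 : 0 < sigma) (PA : ambiguity_set mu beta sigma P).

Lemma ambiguity_Lfun2 :
  @idR R \in Lfun P 2%:E.
Proof.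
apply: (@ae_bounded_Lfun _ _ R P (@idR R) beta); first by rewrite lee1n.
case: PA => P1 _ _; apply: probability1_ae P1 _ => [|x].
  exact: measurable_itv.
by rewrite /= in_itv/= => /andP[x0 xb]; rewrite ger0_norm.
Qed.

(** Cantelli's inequality for [mu - X] at deviation [mu - p] bounds the probability of [X <= p],
    hence of [X < p]. The bound increases with the variance, so [sigma ^+ 2] may replace it. *)
Lemma cantelli_tail (p : R) : p < mu ->
  (((mu - p) ^+ 2 / ((mu - p) ^+ 2 + sigma ^+ 2))%:E <=
   P [set x : R | (p <= x)%R])%E.
Proof.
move=> pmu; have [_ EX VX] := PA.
have X2 := ambiguity_Lfun2.
have t0 : 0 < mu - p by rewrite subr_gt0.
have mtail : measurable ([set x | p <= x] : set (measurableTypeR R)).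
  by rewrite -set_itvcy; exact: measurable_itv.
have X1 : @idR R \in Lfun P 1.
  by apply: Lfun_subset12 X2; exact: fin_num_measure.
pose Y : {RV P >-> R} := (cst mu \- @idR R)%R.
have Y2 : (Y : _ -> R) \in Lfun P 2%:E.
  by rewrite /Y rpredB ?lee1n//= => _; exact: Lfun_cst.
have EY : ('E_P[Y] = 0)%E.
  by rewrite expectationB ?Lfun_cst//= expectation_cst EX subee.
have VY : 'V_P[Y] = 'V_P[@idR R] by rewrite varianceB_cst_l.
have := cantelli Y2 t0; rewrite EY VY.
set v := fine _.
have [v0 vs] : 0 <= v /\ v <= sigma ^+ 2.
  move: VX; rewrite variance_le_sqr ?(ltW sigma_gt0)// => VX; split.
    exact/fine_ge0/variance_ge0.
  by move: VX; rewrite -(@fineK _ 'V_P[_]) ?lee_fin// variance_fin_num.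
have YE : [set x | ((mu - p)%:E <= (Y x)%:E - 0)%E] =
    [set` `]-oo, p]] :> set (measurableTypeR R).
  by apply/seteqP; split => x /=; rewrite in_itv/= sube0 lee_fin /idR; lra.
move=> C; have {C} : (P (~` [set x | (p <= x)%R]) <=
    (v / (v + (mu - p) ^+ 2))%:E)%E.
  apply: le_trans C; apply: le_measure; rewrite ?inE.
  - exact: measurableC.
  - by rewrite YE; exact: measurable_itv.
  - by move=> x /= /negP; rewrite -ltNge sube0 lee_fin /idR; lra.
rewrite probability_setC// => C.
have -> : P [set x | p <= x] = (fine (P [set x | p <= x]))%:E.
  by rewrite fineK// fin_num_measure.
move: C; rewrite -{1}[P _]fineK ?fin_num_measure// -EFinB !lee_fin.
set q := fine _ => C.
have t2 : 0 < (mu - p) ^+ 2 by rewrite exprn_gt0.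
move: C; set t := (mu - p) ^+ 2 in t2 *.
rewrite ler_pdivlMr; last by rewrite ltr_wpDl.
rewrite ler_pdivrMr; last by rewrite ltr_wpDr// exprn_ge0// ltW.
have q1 : 0 <= q by exact/fine_ge0/measure_ge0.
move: (sigma ^+ 2) vs => s vs.
nra.
Qed.

Lemma markov_tail (p : R) : p < mu -> mu < beta -> 0 < p ->
  (((mu - p) / (beta - p))%:E <= P [set x : R | (p <= x)%R])%E.
Proof.
move=> pmu mub p0; have [P1 EX _] := PA.
have mtail : measurable ([set x | p <= x] : set (measurableTypeR R)).
  by rewrite -set_itvcy; exact: measurable_itv.
pose A : set (measurableTypeR R) := [set x | p <= x].
have Afin : P A \is a fin_num by exact: fin_num_measure.
(* [x <= p + (beta - p) 1_{x >= p}] on [0, beta]; take expectations. *)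
pose Z : measurableTypeR R -> R := cst p \+ (beta - p) \o* \1_A.
have le_XZ : (mu%:E <= 'E_P[Z])%E.
  (* The law charges only [[0, beta]], so truncating at 0 alters the identity on a null set only; it
     gives the pointwise nonnegativity that [expectation_le] asks for. *)
  pose X : measurableTypeR R -> R := fun x => Num.max 0 x.
  have mX : measurable_fun setT X by exact: measurable_maxr.
  have -> : (mu%:E = 'E_P[X])%E.
    rewrite -EX unlock; apply: ae_eq_integral => //.
    - exact/measurable_EFinP.
    - apply: probability1_ae P1 _ => [|x]; first exact: measurable_itv.
      by rewrite /= in_itv/= => /andP[x0 _] _; rewrite /X max_r.
  apply: expectation_le.
  - exact: mX.
  - by apply: measurable_funD => //; exact: measurable_funM.
  - by move=> x; rewrite /X le_max lexx.
  - move=> x; rewrite /Z/=; apply: addr_ge0; first exact: ltW.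
    by apply: mulr_ge0 => //; lra.
  - apply: probability1_ae P1 _ => [|x]; first exact: measurable_itv.
    rewrite /= in_itv/= => /andP[x0 xb]; rewrite /X /Z max_r//= indicE.
    have [xp|xp] := leP p x; first by rewrite mem_set// mul1r subrKC.
    by rewrite memNset ?mul0r ?addr0 ?ltW// /A/=; apply/negP; rewrite -ltNge.
have EZ : ('E_P[Z] = p%:E + (beta - p)%:E * P A)%E.
  have I1 : (\1_A : measurableTypeR R -> R) \in Lfun P 1.
    by apply/Lfun1_integrable; exact: integrable_indic.
  rewrite expectationD ?Lfun_cst ?Lfun_scale// expectation_cst.
  by rewrite expectationZl// expectation_indic.
move: le_XZ; rewrite EZ -[P A]fineK// -EFinM -EFinD !lee_fin.
rewrite ler_pdivrMr; last by lra.
by move=> ?; lra.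
Qed.

End tail_bounds.

(** * Maxima of the Cantelli and Markov curves *)

Section optimum.
Context {R : realType}.

(** Cardano: the two cube roots [a], [b] satisfy [a ^+ 3 + b ^+ 3 = 2 * c] and [a * b = -1], so
    expanding [(a + b) ^+ 3] gives the cubic. *)
Lemma kappa_cubic (mu sigma : R) :
  kappa mu sigma ^+ 3 + 3 * kappa mu sigma = 2 * (mu / sigma).
Proof.
rewrite /kappa; set c := mu / sigma; set s := Num.sqrt _.
have s2 : s ^+ 2 = 1 + c ^+ 2 by rewrite sqr_sqrtr// addr_ge0// sqr_ge0.
set a := cbrt (c + s); set b := cbrt (c - s).
have a3 : a ^+ 3 = c + s := cbrtK _.
have b3 : b ^+ 3 = c - s := cbrtK _.
have ab : a * b = -1.
  have : (a * b) ^+ 3 = (-1) ^+ 3.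
    by rewrite exprMn a3 b3 mulrC -subr_sqr s2; ring.
  set x := a * b => x3.
  (* The quadratic factor has no real root, so -1 is the only real cube root of -1. *)
  have : (x + 1) * (x ^+ 2 - x + 1) = 0 by move: x3; rewrite !exprS !expr0; nra.
  move/eqP; rewrite mulf_eq0 => /orP[/eqP|/eqP] h; first lra.
  by have := sqr_ge0 (x - 1); nra.
have -> : (a + b) ^+ 3 + 3 * (a + b) = a ^+ 3 + b ^+ 3 + 3 * (a + b) * (a * b + 1).
  by ring.
by rewrite a3 b3 ab; ring.
Qed.

Definition cantelli_revenue (mu sigma p : R) : R :=
  p * ((mu - p) ^+ 2 / ((mu - p) ^+ 2 + sigma ^+ 2)).

Definition markov_revenue (mu beta p : R) : R :=
  p * ((mu - p) / (beta - p)).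

Lemma price_l_cubic (mu sigma : R) : 0 < sigma ->
  let t := mu - price_l mu sigma in
  t ^+ 3 + 3 * sigma ^+ 2 * t = 2 * mu * sigma ^+ 2.
Proof.
move=> s0 /=; rewrite /price_l subKr.
have -> : (sigma * kappa mu sigma) ^+ 3 + 3 * sigma ^+ 2 * (sigma * kappa mu sigma)
  = sigma ^+ 3 * (kappa mu sigma ^+ 3 + 3 * kappa mu sigma) by ring.
by rewrite kappa_cubic; field; rewrite gt_eqF.
Qed.

Lemma price_l_bounds (mu sigma : R) : 0 < sigma -> 0 < mu ->
  mu / 3 < price_l mu sigma < mu.
Proof.
move=> s0 mu0; have := price_l_cubic mu sigma s0; set t := mu - _ => /= h.
have s2 : 0 < sigma ^+ 2 by rewrite exprn_gt0.
have t0 : 0 < t.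
  rewrite ltNge; apply/negP => t0.
  have : t ^+ 3 <= 0 by rewrite exprS; apply: mulr_le0_ge0 => //; exact: sqr_ge0.
  have : 0 < mu * sigma ^+ 2 by exact: mulr_gt0.
  by nra.
have t3 : 0 < t ^+ 3 by rewrite exprn_gt0.
have tm : 3 * t < 2 * mu.
  rewrite -(ltr_pM2r s2); lra.
by apply/andP; rewrite /t in t0 tm; split; lra.
Qed.

Lemma price_l_revenue (mu sigma : R) : 0 < sigma -> 0 < mu ->
  cantelli_revenue mu sigma (price_l mu sigma) =
  mu - 3 / 2 * (mu - price_l mu sigma).
Proof.
move=> s0 mu0; have /andP[p0 p1] := price_l_bounds mu sigma s0 mu0.
have := price_l_cubic mu sigma s0; rewrite /cantelli_revenue.
have s2 : 0 < sigma ^+ 2 by rewrite exprn_gt0.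
move: (price_l _ _) p0 p1 (sigma ^+ 2) s2 => p p0 p1 s s2 h.
have t2 : 0 < (mu - p) ^+ 2 by rewrite exprn_gt0// subr_gt0.
have d0 : (mu - p) ^+ 2 + s != 0 by rewrite gt_eqF// addr_gt0.
rewrite mulrA; apply: (mulIf d0); rewrite divfK//.
move: h; rewrite !exprS !expr0 /=; nra.
Qed.

Lemma cantelli_revenue_max (mu sigma p : R) :
    0 < sigma -> 0 < mu -> p < mu ->
  cantelli_revenue mu sigma p <= cantelli_revenue mu sigma (price_l mu sigma).
Proof.
move=> s0 mu0 pmu; rewrite price_l_revenue//.
have /andP[q0 q1] := price_l_bounds mu sigma s0 mu0.
have := price_l_cubic mu sigma s0.
have s2 : 0 < sigma ^+ 2 by rewrite exprn_gt0.
rewrite /cantelli_revenue.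
move: (price_l _ _) q0 q1 (sigma ^+ 2) s2 => q q0 q1 s s2 /= h.
have : 0 < mu - p by lra.
have -> : p = mu - (mu - p) by lra.
move: (mu - p) => u u0; rewrite subKr.
move: h q0 q1; have -> : q = mu - (mu - q) by lra.
move: (mu - q) => t; rewrite subKr => h q0 q1.
have t0 : 0 < t by lra.
rewrite mulrA ler_pdivrMr; last by rewrite ltr_wpDl// sqr_ge0.
suff : 0 <= (mu - 3/2*t) * (u^+2 + s) - (mu - u) * u^+2 by lra.
have d0 : 0 < 2 * mu - 3 * t by lra.
(* Multiplying by [2 * mu - 3 * t] lets the cubic eliminate [s]. The gap then factors with a double
   root at [u = t], the maximiser. *)
rewrite -(pmulr_rge0 _ d0).
have sE : (2 * mu - 3 * t) * s = t ^+ 3 by lra.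
have -> : (2 * mu - 3 * t) * ((mu - 3/2*t) * (u^+2 + s) - (mu - u) * u^+2) =
   (2 * mu - 3 * t) * (u - t) ^+ 2 * (u + t / 2).
  transitivity ((mu - 3 / 2 * t) * ((2 * mu - 3 * t) * u ^+ 2 +
    (2 * mu - 3 * t) * s) - (2 * mu - 3 * t) * ((mu - u) * u ^+ 2)); first ring.
  by rewrite sE; field.
apply: mulr_ge0; first by apply: mulr_ge0; [exact: ltW | exact: sqr_ge0].
by lra.
Qed.

(** With [x = beta - p] the revenue is [beta + (beta - mu) - (x + beta * (beta - mu) / x)], and
    AM-GM bounds the bracket below by twice the square root. *)
Lemma markov_revenue_max (mu beta p : R) : 0 < mu -> mu < beta -> p < mu ->
  markov_revenue mu beta p <=
  beta + (beta - mu) - 2 * Num.sqrt (beta * (beta - mu)).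
Proof.
move=> mu0 mub pmu; rewrite /markov_revenue mulrA ler_pdivrMr; last by lra.
have h : 0 <= beta * (beta - mu) by apply: mulr_ge0; lra.
have := sqr_sqrtr h; set r := Num.sqrt _ => r2.
by have := sqr_ge0 (beta - p - r); nra.
Qed.

Lemma sqrt_beta_bounds (mu beta : R) : 0 < mu -> mu < beta ->
  beta - mu < Num.sqrt (beta * (beta - mu)) < beta.
Proof.
move=> mu0 mub.
have h : 0 <= beta * (beta - mu) by apply: mulr_ge0; lra.
have := sqr_sqrtr h; have := sqrtr_ge0 (beta * (beta - mu)).
set r := Num.sqrt _ => r0 r2.
by apply/andP; split; nra.
Qed.

Lemma price_m_bounds (mu beta : R) : 0 < mu -> mu < beta ->
  0 < price_m mu beta < mu.
Proof.
move=> mu0 mub; have := sqrt_beta_bounds mu beta mu0 mub; rewrite /price_m; lra.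
Qed.

Lemma price_m_revenue (mu beta : R) : 0 < mu -> mu < beta ->
  markov_revenue mu beta (price_m mu beta) =
  beta + (beta - mu) - 2 * Num.sqrt (beta * (beta - mu)).
Proof.
move=> mu0 mub; have /andP[_] := sqrt_beta_bounds mu beta mu0 mub.
have /andP[+ _] := sqrt_beta_bounds mu beta mu0 mub.
have h : 0 <= beta * (beta - mu) by apply: mulr_ge0; lra.
rewrite /markov_revenue /price_m.
have := sqr_sqrtr h; set r := Num.sqrt _ => r2 rb _; rewrite subKr.
have r0 : r != 0 by rewrite gt_eqF//; lra.
rewrite mulrA; apply: (mulIf r0); rewrite divfK//; nra.
Qed.

(* The maxima of the two revenue curves agree when [mu - price_l] equals [t0];
   [sigma_star] is the sigma for which [t0] solves the cubic of [price_l_cubic]. *)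
Lemma price_l_threshold (mu beta sigma : R) : 0 < mu -> mu < beta -> 0 < sigma ->
  let t0 := 4 / 3 * (Num.sqrt (beta * (beta - mu)) - (beta - mu)) in
  (sigma <= sigma_star mu beta -> mu - price_l mu sigma <= t0) /\
  (sigma_star mu beta <= sigma -> t0 <= mu - price_l mu sigma).
Proof.
move=> mu0 mub s0; have := sqrt_beta_bounds mu beta mu0 mub.
have := price_l_bounds mu sigma s0 mu0.
have := price_l_cubic mu sigma s0.
have h : 0 <= beta * (beta - mu) by apply: mulr_ge0; lra.
have := sqr_sqrtr h; rewrite /sigma_star; set r := Num.sqrt (beta * _) => r2.
have q1 : mu - (mu - price_l mu sigma) = price_l mu sigma by rewrite subKr.
rewrite -[X in _ < X < _]q1; set t := mu - price_l _ _ => cub tb /andP[br rb].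
set t0 := 4 / 3 * _; cbv zeta.
set s2 := 32 / 27 * _ * _.
have s20 : 0 <= s2 by rewrite /s2 !mulr_ge0//; lra.
have D2 : (r - (beta - mu)) ^+ 2 = (beta - mu) * (beta + (beta - mu) - 2 * r).
  by rewrite sqrrB r2; ring.
have t0E : t0 ^+ 3 + 3 * s2 * t0 = 2 * mu * s2.
  have -> : t0 ^+ 3 = 64 / 27 * (r - (beta - mu)) * (r - (beta - mu)) ^+ 2.
    by rewrite /t0; field.
  by rewrite D2 /t0 /s2; field.
have S0 : 0 < sigma ^+ 2 by rewrite exprn_gt0.
have lt_s : (sigma <= Num.sqrt s2) = (sigma ^+ 2 <= s2).
  by rewrite -[in LHS](ger0_norm (ltW s0)) -sqrtr_sqr ler_sqrt.
have gt_s : (Num.sqrt s2 <= sigma) = (s2 <= sigma ^+ 2).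
  by rewrite -[in LHS](ger0_norm (ltW s0)) -sqrtr_sqr ler_sqrt// ltW.
rewrite lt_s gt_s.
have t00 : 0 <= t0 by rewrite /t0; lra.
(* [2 * mu - 3 * t0] is twice [beta + (beta - mu) - 2 * r], which [D2] shows to be positive. *)
have t0mu : 3 * t0 < 2 * mu.
  have : 0 < beta + (beta - mu) - 2 * r.
    rewrite -(@pmulr_rgt0 _ (beta - mu)) -?D2 ?exprn_gt0//; lra.
  by rewrite /t0; lra.
move: (sigma ^+ 2) S0 cub {lt_s gt_s} => S S0 cub.
have tt : 0 < t by lra.
(* Difference of the cubics for [t] and [t0]. Both cofactors are positive, so [S - s2] and [t - t0]
   have the same sign. *)
have key : (S - s2) * (2 * mu - 3 * t0) = (t - t0) * (t ^+ 2 + t * t0 + t0 ^+ 2 + 3 * S).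
  move: t0E cub; rewrite !exprS !expr0; nra.
have pos : 0 < t ^+ 2 + t * t0 + t0 ^+ 2 + 3 * S.
  have := sqr_ge0 t; have := sqr_ge0 t0; have := mulr_ge0 (ltW tt) t00; lra.
have pos2 : 0 < 2 * mu - 3 * t0 by lra.
split=> [sS|sS].
  rewrite -subr_le0 -(pmulr_lle0 _ pos) -key pmulr_lle0//; lra.
rewrite -subr_ge0 -(pmulr_lge0 _ pos) -key pmulr_lge0//; lra.
Qed.

End optimum.

(** * Upper bounds on the robust revenue from two-point laws *)

Lemma variance_integral d (T : measurableType d) (R : realType)
    (P : probability T R) (X : T -> R) (m : R) : ('E_P[X] = m%:E)%E ->
  ('V_P[X] = \int[P]_x ((X x - m) ^+ 2)%:E)%E.
Proof.
move=> EX; rewrite /variance unlock EX/= unlock.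
by apply: eq_integral => x _; rewrite expr2.
Qed.

(** Pushing a Bernoulli law forward along this map gives the law with atoms [a] and [u]. *)
Definition two_point (R : realType) (a u : R) : bool -> measurableTypeR R :=
  fun b => if b then u else a.

HB.instance Definition _ (R : realType) (a u : R) :=
  @isMeasurableFun.Build _ _ bool (measurableTypeR R) (two_point R a u)
    (fun _ _ _ => I).

Section upper_bound.
Context (R : realType) (mu beta sigma : R).
Hypotheses (mu_gt0 : 0 < mu) (mu_lt_beta : mu < beta) (sigma_gt0 : 0 < sigma).

(** Mean [mu] forces the weight [q] at [u], and the variance is then [(mu - a) * (u - mu)]. For [p]
    above [a] only the atom [u] can lie in the tail. *)
Lemma two_point_ambiguity (a u : R) : 0 <= a -> a < mu -> mu < u -> u <= beta ->
    (mu - a) * (u - mu) <= sigma ^+ 2 ->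
  exists P, ambiguity_set mu beta sigma P /\
    forall p, a < p -> (P [set x : R | (p <= x)%R] <= ((mu - a) / (u - a))%:E)%E.
Proof.
move=> a0 amu muu ub var; set q := (mu - a) / (u - a).
have ua : u - a != 0 by rewrite gt_eqF//; lra.
have q01 : 0 <= q <= 1.
  apply/andP; split; first by apply: divr_ge0; lra.
  rewrite ler_pdivrMr; lra.
have qE : q * (u - a) = mu - a by rewrite divfK.
pose P : probability (measurableTypeR R) R :=
  distribution (bernoulli_prob q) (two_point R a u).
have tp0 b : 0 <= two_point R a u b by rewrite /two_point; case: b; lra.
have EP : ('E_P[(fun x : R => x)] = mu%:E)%E.
  rewrite unlock integral_distribution/=.
  - rewrite integral_bernoulli_prob//=.
    by rewrite /two_point -!EFinM -EFinD /unstable.onem; congr _%:E; lra.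
  - exact/measurable_EFinP.
  - apply/integrableP; split; first by [].
    by rewrite integral_bernoulli_prob//= -!EFinM -EFinD ltry.
exists P; split; first split.
- rewrite /P /distribution/= /pushforward (_ : _ @^-1` _ = setT) ?probability_setT//.
  apply/seteqP; split => // -[] _ /=; rewrite in_itv/=; lra.
- exact: EP.
- rewrite variance_le_sqr ?(ltW sigma_gt0)// (variance_integral _ _ _ _ _ _ EP).
  rewrite ge0_integral_distribution/=; last first.
  - by move=> y; rewrite lee_fin; exact: sqr_ge0.
  - apply/measurable_EFinP; apply: measurable_funX; exact: measurable_funB.
  rewrite integral_bernoulli_prob//= => [|b]; last by rewrite lee_fin; exact: sqr_ge0.
  rewrite -!EFinM -EFinD lee_fin /unstable.onem; apply: le_trans var.
  by rewrite /two_point; nra.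
- move=> p ap; rewrite /P /distribution/= /pushforward bernoulli_probE//.
  rewrite [X in (_ + _ * X)%E]diracE memNset ?mule0 ?adde0.
    rewrite diracE; case: (_ \in _); rewrite ?mule1 ?mule0// lee_fin.
    by case/andP: q01.
  by rewrite /=; apply/negP; rewrite -ltNge.
Qed.

(** This law shows that prices above [mu] have robust revenue at most 0. *)
Lemma dirac_ambiguity :
  ambiguity_set mu beta sigma (\d_(mu : measurableTypeR R)).
Proof.
pose D : probability (measurableTypeR R) R := \d_(mu : measurableTypeR R).
have Ed (f : R -> R) : measurable_fun setT (f : measurableTypeR R -> R) ->
    (\int[D]_(x in [set: measurableTypeR R]) (f x)%:E = (f mu)%:E)%E.
  move=> mf; rewrite integral_dirac//; last exact/measurable_EFinP.
  by rewrite diracT mul1e.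
have EP : ('E_D[(fun x : R => x)] = mu%:E)%E.
  by rewrite unlock Ed.
split.
- by rewrite /= diracE mem_set//= in_itv/= !ltW.
- exact: EP.
- rewrite variance_le_sqr ?(ltW sigma_gt0)// (variance_integral _ _ _ _ _ _ EP).
  rewrite Ed; last by apply: measurable_funX; exact: measurable_funB.
  by rewrite lee_fin subrr expr0n sqr_ge0.
Qed.

(** An atom at [p] itself would count in the tail, so the lower atom [a] stays strictly below [p],
    at a loss of at most [e]. Hence the curves are bounded at all [a] in [[0, mu)], not just at
    [p]. *)
Lemma robust_revenue_le (p M : R) : 0 < p ->
    (forall a, 0 <= a -> a < mu -> cantelli_revenue mu sigma a <= M) ->
    (forall a, 0 <= a -> a < mu -> markov_revenue mu beta a <= M) ->
  (robust_revenue mu beta sigma p <= M%:E)%E.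
Proof.
move=> p0 cM mM; have M0 : 0 <= M.
  by apply: le_trans (mM 0 _ _) => //; rewrite /markov_revenue mul0r.
have [pmu|mup] := leP p mu; last first.
  apply: ereal_inf_le; exists 0%E; last by rewrite lee_fin.
  exists (\d_(mu : measurableTypeR R)); first exact: dirac_ambiguity.
  by rewrite /= diracE memNset ?mule0//=; apply/negP; rewrite -ltNge.
apply/lee_addgt0Pr => e e0.
(* Close enough to [p] for [p * (M / a) <= M + e]. *)
pose a := p * ((M + e / 2) / (M + e)).
have aE : a * (M + e) = p * (M + e / 2).
  by rewrite /a -mulrA divfK// gt_eqF//; lra.
have a0 : 0 < a by apply: mulr_gt0 => //; apply: divr_gt0; lra.
have ap : a < p by rewrite -subr_gt0 -(@pmulr_lgt0 _ (M + e)); nra.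
have t0 : 0 < mu - a by lra.
have s0 : 0 < sigma ^+ 2 by rewrite exprn_gt0.
(* The upper atom [mu + m] is as high as support and variance permit, which minimises its weight. If
   the support binds, that weight is the Markov bound at [a]; if the variance binds, the Cantelli
   bound. *)
pose m := Num.min (beta - mu) (sigma ^+ 2 / (mu - a)).
have m0 : 0 < m by rewrite lt_min subr_gt0 mu_lt_beta divr_gt0.
have mb : m <= beta - mu by rewrite ge_min lexx.
have ms : (mu - a) * m <= sigma ^+ 2.
  by rewrite mulrC -ler_pdivlMr// ge_min lexx orbT.
have [P [PA Pp]] := @two_point_ambiguity a (mu + m) (ltW a0) ltac:(lra) ltac:(lra)
   ltac:(lra) ltac:(by rewrite [mu + m]addrC addrK).
have aq : a * ((mu - a) / (mu + m - a)) <= M.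
  have [mE|mE] : m = beta - mu \/ m = sigma ^+ 2 / (mu - a).
    by rewrite /m /Num.min; case: ifP; [left|right].
  - by rewrite mE subrKC; apply: mM; lra.
  - apply: le_trans (cM a _ _); [|lra..]; rewrite /cantelli_revenue ler_pM2l//.
    rewrite mE le_eqVlt; apply/orP; left; apply/eqP; field.
    by rewrite !gt_eqF//; nra.
apply: ereal_inf_le; exists (p%:E * P [set x : R | (p <= x)%R])%E; first by exists P.
apply: (@le_trans _ _ (p%:E * ((mu - a) / (mu + m - a))%:E)%E).
  by rewrite lee_pmul2l ?lte_fin//; exact: Pp.
rewrite -EFinM -EFinD lee_fin; move: aq; set q := _ / _ => aq.
rewrite -(ler_pM2l (_ : 0 < M + e / 2)); last lra.
have -> : (M + e / 2) * (p * q) = (a * q) * (M + e) by rewrite mulrAC aE; ring.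
nra.
Qed.

Lemma cantelli_revenue_le (p : R) : 0 < p -> p < mu ->
  ((cantelli_revenue mu sigma p)%:E <= robust_revenue mu beta sigma p)%E.
Proof.
move=> p0 pmu; apply: le_ereal_inf_tmp => _ [P PA <-].
by rewrite EFinM lee_pmul2l ?lte_fin//; exact: cantelli_tail PA _ _.
Qed.

Lemma markov_revenue_le (p : R) : 0 < p -> p < mu ->
  ((markov_revenue mu beta p)%:E <= robust_revenue mu beta sigma p)%E.
Proof.
move=> p0 pmu; apply: le_ereal_inf_tmp => _ [P PA <-].
by rewrite EFinM lee_pmul2l ?lte_fin//; exact: markov_tail PA _ _ _ _.
Qed.

(** * Assembling the optimal price *)

Lemma argsup_robust_revenue (p M : R) : 0 < p -> p < mu ->
    (M%:E <= robust_revenue mu beta sigma p)%E ->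
    (forall a, 0 <= a -> a < mu -> cantelli_revenue mu sigma a <= M) ->
    (forall a, 0 <= a -> a < mu -> markov_revenue mu beta a <= M) ->
  argsup `]0, beta] (robust_revenue mu beta sigma) p.
Proof.
move=> p0 pmu Mp cM mM.
have Dp : `]0, beta]%classic p
  by rewrite /= in_itv/= p0 ltW// (lt_trans pmu).
split=> //; apply/eqP; rewrite eq_le; apply/andP; split.
  by apply: ereal_sup_ubound; exists p.
apply: ge_ereal_sup => _ [x + <-]; rewrite /= in_itv/= => /andP[x0 _].
exact: le_trans (robust_revenue_le x M x0 cM mM) Mp.
Qed.

End upper_bound.

Theorem proposition4p1 (R : realType) (mu beta sigma : R)
    (mu_gt0 : 0 < mu) (mu_lt_beta : mu < beta)
    (sigma_gt0 : 0 < sigma)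
    (sigma_le : sigma <= Num.sqrt (mu * (beta - mu))) :
  (sigma <= sigma_star mu beta ->
     argsup `]0, beta] (robust_revenue mu beta sigma) (price_l mu sigma)) /\
  (sigma_star mu beta <= sigma ->
     argsup `]0, beta] (robust_revenue mu beta sigma) (price_m mu beta)).
Proof.
have [small large] := price_l_threshold mu beta sigma mu_gt0 mu_lt_beta sigma_gt0.
have /andP[pl0 pl1] := price_l_bounds mu sigma sigma_gt0 mu_gt0.
have /andP[pm0 pm1] := price_m_bounds mu beta mu_gt0 mu_lt_beta.
have pl_gt0 : 0 < price_l mu sigma by lra.
split=> [/small|/large] le_t.
- apply: (argsup_robust_revenue _ _ _ _ mu_gt0 mu_lt_beta sigma_gt0
    _ (cantelli_revenue mu sigma (price_l mu sigma))) => //.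
  + exact: cantelli_revenue_le.
  + by move=> a a0 amu; exact: cantelli_revenue_max.
  (* [le_t] rearranges to: the Markov maximum is at most [mu - 3 / 2 * (mu - price_l mu sigma)], the
     Cantelli maximum. The other case reverses it. *)
  + move=> a a0 amu; apply: le_trans (markov_revenue_max _ _ _ _ _ _) _ => //.
    rewrite price_l_revenue//; lra.
- apply: (argsup_robust_revenue _ _ _ _ mu_gt0 mu_lt_beta sigma_gt0
    _ (markov_revenue mu beta (price_m mu beta))) => //.
  + exact: markov_revenue_le.
  + move=> a a0 amu; apply: le_trans (cantelli_revenue_max _ _ _ _ _ _) _ => //.
    rewrite price_l_revenue// price_m_revenue//; lra.
  + by move=> a a0 amu; rewrite price_m_revenue//; exact: markov_revenue_max.
Qed.
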